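(* Let $(X,C)$ be a locally separable convexity space such that there is a chain $c_1\subseteq c_2\subseteq\cdots$ of compact convex sets, each of which has Radon number at most $r$, with $\bigcup_i c_i=X$. Then for every $\varepsilon>0$, $(X,C)$ has weak $\varepsilon$-nets of finite size.
   Context: A convexity space is a pair $(X,C)$ with $C\subseteq 2^X$ such that $\emptyset, X\in C$ and $C$ is closed under arbitrary intersections. $(X,C)$ is locally separable if there is $B\subseteq C$ such that $C$ equals the family of all intersections of members of $B$, and for every finite $Y\subseteq X$ and every $b\in B$ there is $\bar b\in B$ such that $b\cap Y$ and $\bar b\cap Y$ form a partition of $Y$. A family $D$ is compact if every $D'\subseteq D$ with $\bigcap D'=\emptyset$ has a finite $D''\subseteq D'$ with $\bigcap D''=\emptyset$. A convex set $c\in C$ is compact if the restricted convexity space $(c,\{c'\cap c: c'\in C\})$ is compact, and the Radon number of $c$ is the Radon number of this restricted space. For a convexity space $(Z,D)$, $conv(Y)$ is the intersection of all members of $D$ containing $Y$; $D$ Radon-shatters $Y$ if for every partition $Y=Y_1\sqcup Y_2$, $conv(Y_1)\cap conv(Y_2)=\emptyset$; the Radon number is the minimum $r$ such that no set of size $r$ is Radon-shattered. A weak $\varepsilon$-net for $C$ over a probability distribution $\mu$ is a set $S\subseteq X$ meeting every $c\in C$ with $\mu(c)\ge\varepsilon$; ''has weak $\varepsilon$-nets of finite size'' means there is a finite $\beta$, independent of $\mu$, such that for every probability distribution $\mu$ on $X$ (all sets considered measurable) there is a weak $\varepsilon$-net over $\mu$ of size at most $\beta$. *)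

(* Defs.v *)
From mathcomp Require Import all_boot all_order all_algebra.
From mathcomp Require Import all_classical all_reals all_analysis.
Set Implicit Arguments. Unset Strict Implicit. Unset Printing Implicit Defensive.
Import Order.TTheory GRing.Theory Num.Theory.
Import numFieldNormedType.Exports.
Local Open Scope classical_set_scope.
Local Open Scope ring_scope.

Definition convexity_space (X : Type) (C : set (set X)) : Prop :=
  C set0 /\ C setT /\
  (forall F : set (set X), F `<=` C -> C (\bigcap_(c in F) c)).

Definition locally_separable (X : Type) (C : set (set X)) : Prop :=
  exists B : set (set X), B `<=` C /\
    C = [set \bigcap_(b in F) b | F in [set F : set (set X) | F `<=` B]] /\
    (forall Y : set X, finite_set Y -> forall b, B b ->
       exists2 b', B b' &
         (b `&` Y) `|` (b' `&` Y) = Y /\ (b `&` Y) `&` (b' `&` Y) = set0).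

Definition restrict (X : Type) (C : set (set X)) (Z : set X) : set (set X) :=
  [set c' `&` Z | c' in C].

(* Compactness of a family D of subsets of a ground set Z (intersections are
   taken inside Z, so the empty subfamily has intersection Z). *)
Definition compact_family (X : Type) (Z : set X) (D : set (set X)) : Prop :=
  forall D' : set (set X), D' `<=` D ->
    Z `&` \bigcap_(d in D') d = set0 ->
    exists2 D'' : set (set X), D'' `<=` D' /\ finite_set D'' &
      Z `&` \bigcap_(d in D'') d = set0.

Definition compact_convex (X : Type) (C : set (set X)) (c : set X) : Prop :=
  C c /\ compact_family c (restrict C c).

Definition conv (X : Type) (Z : set X) (D : set (set X)) (Y : set X) : set X :=
  Z `&` \bigcap_(d in [set d | D d /\ Y `<=` d]) d.

Definition radon_shatters (X : Type) (Z : set X) (D : set (set X)) (Y : set X)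
  : Prop :=
  forall Y1 Y2 : set X, Y1 `|` Y2 = Y -> Y1 `&` Y2 = set0 ->
    conv Z D Y1 `&` conv Z D Y2 = set0.

(* The Radon number of (Z, D) is the minimum r' such that no subset of Z of
   size r' is Radon-shattered; "Radon number at most r" means such an r' <= r
   exists. *)
Definition radon_number_le (X : Type) (Z : set X) (D : set (set X)) (r : nat)
  : Prop :=
  exists2 r' : nat, (r' <= r)%N &
    forall Y : set X, Y `<=` Z -> (Y #= `I_r')%card -> ~ radon_shatters Z D Y.

Definition convex_radon_le (X : Type) (C : set (set X)) (c : set X) (r : nat)
  : Prop := radon_number_le c (restrict C c) r.

Definition prob_distr (R : realType) (X : Type) (mu : set X -> R) : Prop :=
  (forall A, 0 <= mu A) /\ mu setT = 1 /\
  (forall F : nat -> set X, trivIset setT F ->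
     (fun n => \sum_(i < n) mu (F i)) @ \oo --> mu (\bigcup_n F n)).

Definition weak_eps_net (R : realType) (X : Type) (C : set (set X))
  (mu : set X -> R) (eps : R) (S : set X) : Prop :=
  forall c, C c -> eps <= mu c -> c `&` S !=set0.

(* (X,C) has weak eps-nets of finite size: a bound beta, independent of mu,
   such that every probability distribution admits a weak eps-net with at most
   beta points (the image of {0,...,beta-1} under some map). *)
Definition has_finite_weak_eps_nets (R : realType) (X : Type)
  (C : set (set X)) (eps : R) : Prop :=
  exists beta : nat, forall mu : set X -> R, prob_distr mu ->
    exists f : nat -> X, weak_eps_net C mu eps (f @` `I_beta).

(* Main.v *)
(* Local separability and a finite Radon number bound the VC dimension of the
   generating family B, so for every probability mu a number of members of B
   independent of mu approximates each member of B up to a small mu-measure.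
   Helly's theorem and compactness of some c_i carrying almost all of mu give a
   centerpoint: a point of every convex set of measure > 1 - eta, where eta depends
   only on r. A convex d missing the centerpoint lies in some b in B of measure at
   most 1 - eta, hence its measure relative to a member g of the approximation
   close to b exceeds mu(d) by a factor 1 + eta / 2. Recursing on mu conditioned on
   each such g, the threshold exceeds 1 after boundedly many rounds. *)
Require Import Defs.
From mathcomp Require Import all_boot all_order all_algebra.
Set Implicit Arguments. Unset Strict Implicit. Unset Printing Implicit Defensive.

(** * Shattered sets in a finite type and the Sauer-Shelah lemma *)

Definition shatters (T : finType) (F : {set {set T}}) (S : {set T}) :=
  [forall A : {set T}, (A \subset S) ==> [exists D in F, D :&: S == A]].

Lemma shattersP (T : finType) (F : {set {set T}}) (S : {set T}) :
  reflect (forall A : {set T}, A \subset S -> exists2 D, D \in F & D :&: S = A)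
    (shatters F S).
Proof.
apply: (iffP forallP) => [h A AS|h A].
  by have /implyP/(_ AS)/existsP[D /andP[DF /eqP]] := h A; exists D.
by apply/implyP => /h[D DF <-]; apply/existsP; exists D; rewrite DF eqxx.
Qed.

Lemma shattersS (T : finType) (F F' : {set {set T}}) (S : {set T}) :
  F \subset F' -> shatters F S -> shatters F' S.
Proof.
move=> /subsetP FF' /shattersP h; apply/shattersP => A /h[D DF <-].
by exists D => //; apply: FF'.
Qed.

Lemma shatters_notin (T : finType) (F : {set {set T}}) (S : {set T}) x (v : bool) :
  (forall D, D \in F -> (x \in D) = v) -> shatters F S -> x \notin S.
Proof.
move=> hF /shattersP h; apply/negP => xS.
have [D DF DS] := h (if v then set0 else [set x]) ltac:(by case: (v); rewrite ?sub0set ?sub1set).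
have := in_setI x D S; rewrite DS xS (hF _ DF) andbT.
by case: (v); rewrite !inE ?eqxx.
Qed.

(* Pajor's form of the Sauer-Shelah lemma. Splitting the family at a point x,
   a set S shattered by both halves yields two shattered sets, S and x |: S. *)
Lemma leq_card_shatters (T : finType) (F : {set {set T}}) :
  #|F| <= #|[set S | shatters F S]|.
Proof.
have [n] := ubnP #|F|; elim: n F => // n IHn F; rewrite ltnS => leFn.
have [F1|] := leqP #|F| 1.
  case: (set_0Vmem F) => [->|[D DF]]; first by rewrite cards0.
  apply: (leq_trans F1); apply/card_gt0P; exists set0; rewrite inE.
  by apply/shattersP => A; rewrite subset0 => /eqP ->; exists D; rewrite ?setI0.
move=> /card_gt1P[D1 [D2 [D1F D2F neD]]].
have [x xD] : exists x, (x \in D1) != (x \in D2).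
  apply/existsP; rewrite -negb_forall; apply: contra neD => /forallP h.
  by apply/eqP/setP => x; apply/eqP.
pose G v := [set D in F | (x \in D) == v].
have GF v : G v \subset F by apply/subsetP => D; rewrite inE => /andP[].
have Gx v D : D \in G v -> (x \in D) = v by rewrite inE => /andP[_ /eqP].
have cardG : #|F| = #|G true| + #|G false|.
  rewrite -(cardsID (G true) F); congr (_ + _); apply: eq_card => D; rewrite !inE.
    by case: (D \in F); rewrite /= ?andbF.
  by case: (D \in F); rewrite /= ?andbF // andbT; case: (x \in D).
have G0 v : 0 < #|G v|.
  apply/card_gt0P; exists (if (x \in D1) == v then D1 else D2); rewrite inE.
  case: eqP => [->|]; first by rewrite D1F eqxx.
  by rewrite D2F; move: xD; case: (x \in D1); case: (x \in D2); case: v.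
pose sh v := [set S | shatters (G v) S].
have IHG v : #|G v| <= #|sh v|.
  apply: IHn; apply: leq_trans leFn; rewrite cardG.
  by case: v; [rewrite -ltn_psubLR ?subnn | rewrite -[X in X < _]add0n ltn_add2r]; rewrite ?subnn G0.
have shx v S : S \in sh v -> x \notin S.
  by rewrite inE; apply: shatters_notin => D; apply: Gx.
pose both := [set x |: S | S in sh true :&: sh false].
have cboth : #|both| = #|sh true :&: sh false|.
  rewrite card_in_imset // => S S' /setIP[Sx _] /setIP[S'x _] eqS.
  by rewrite -(setU1K (shx _ _ Sx)) eqS (setU1K (shx _ _ S'x)).
apply: (@leq_trans (#|(sh true :|: sh false) :|: both|)); last first.
  apply: subset_leq_card; apply/subsetP => S; rewrite !inE => /orP[/orP[]|].
  - exact: shattersS (GF _).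
  - exact: shattersS (GF _).
  move=> /imsetP[S' /setIP[St Sf] ->].
  have xS' := shx _ _ St.
  apply/shattersP => A AS.
  have AS' : A :\ x \subset S'.
    by apply/subsetP => y /setD1P[yx /(subsetP AS)/setU1P[/eqP|//]]; rewrite (negPf yx).
  have [D DG DS] : exists2 D, D \in G (x \in A) & D :&: S' = A :\ x.
    by case: (x \in A); move: St Sf; rewrite !inE => /shattersP St /shattersP Sf;
      [apply: St | apply: Sf].
  exists D; first exact: (subsetP (GF _)) DG.
  apply/setP => y; rewrite !inE; have [->|yx] := eqVneq y x.
    by rewrite (Gx _ _ DG) andbT.
  by have := in_setI y D S'; rewrite DS !inE yx /= => ->.
rewrite cardsU disjoint_setI0 ?cards0 ?subn0.
  by rewrite cboth cardsU subnK ?cardG ?leq_add // -cardsUI leq_addl.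
rewrite -setI_eq0; apply/eqP/setP => S; rewrite !inE; apply/negP => /andP[h].
move=> /imsetP[S' _ eS]; have /negP : x \notin S.
  by case/orP: h => h; [apply: (shx true)|apply: (shx false)]; rewrite inE.
by apply; rewrite eS setU11.
Qed.

(** A set with fewer than [r] points is encoded by its enumeration, padded with [None] to length
    [r]; [im] decodes it. *)
Lemma card_small_sets (T : finType) r :
  #|[set S : {set T} | #|S| < r]| <= #|T|.+1 ^ r.
Proof.
rewrite -card_option -[r in _ ^ r]card_ord -card_ffun.
pose im (f : {ffun 'I_r -> option T}) := [set x | Some x \in codom f].
apply: leq_trans (leq_imset_card im _).
apply: subset_leq_card; apply/subsetP => S; rewrite inE => Sr.
apply/imsetP; exists [ffun i : 'I_r => onth (enum S) i] => //.
apply/setP => x; rewrite inE; apply/idP/codomP => [xS|[i]].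
  have ltxr : index x (enum S) < r.
    by apply: leq_trans Sr; rewrite ltnS; apply: leq_trans (index_size _ _) _; rewrite -cardE.
  exists (Ordinal ltxr); rewrite ffunE /= onthE (nth_map x) ?nth_index ?index_mem ?mem_enum //.
rewrite ffunE => /esym e; rewrite -mem_enum.
by apply/onthP; exists i.
Qed.

Lemma sauer_shelah (T : finType) (F : {set {set T}}) r :
  #|T|.+1 ^ r < #|F| -> exists2 S : {set T}, r <= #|S| & shatters F S.
Proof.
move=> ltF; apply/exists_inP; apply: contraTT ltF; rewrite -leqNgt => h.
apply: leq_trans (leq_card_shatters F) _; apply: leq_trans (card_small_sets T r).
apply: subset_leq_card; apply/subsetP => S; rewrite !inE ltnNge => Sh.
by apply: contra h => rS; apply/existsP; exists S; rewrite rS Sh.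
Qed.

From mathcomp Require Import all_classical all_reals all_analysis.
From mathcomp Require Import ring lra zify.
Import Order.TTheory GRing.Theory Num.Theory.
Local Open Scope classical_set_scope.
Local Open Scope ring_scope.

(** * Finitely additive contents and greedy hitting sets *)

Definition finitely_additive (R : realType) (X : Type) (mu : set X -> R) :=
  (forall A, 0 <= mu A) /\
  (forall A B, A `&` B = set0 -> mu (A `|` B) = mu A + mu B).

Lemma content0 (R : realType) (X : Type) (mu : set X -> R) :
  finitely_additive mu -> mu set0 = 0.
Proof.
move=> [_ muU]; have := muU _ _ (setI0 (@set0 X)); rewrite setU0; lra.
Qed.

Lemma content_split (R : realType) (X : Type) (mu : set X -> R) A B :
  finitely_additive mu -> mu A = mu (A `&` B) + mu (A `\` B).
Proof.
by move=> [_ muU]; rewrite -muU -?setDE ?setUIDK //; apply/seteqP; split=> x // [[]] ? ? [].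
Qed.

Lemma le_content (R : realType) (X : Type) (mu : set X -> R) A B :
  finitely_additive mu -> A `<=` B -> mu A <= mu B.
Proof.
move=> fmu AB; rewrite (content_split B A fmu) (setIidr AB).
by have := fmu.1 (B `\` A); lra.
Qed.

Lemma content_capI (R : realType) (X : Type) (mu : set X -> R) A B :
  finitely_additive mu -> mu setT = 1 -> mu A + mu B - 1 <= mu (A `&` B).
Proof.
move=> fmu mu1; rewrite (content_split A B fmu).
have := le_content fmu (@subsetT _ (B `|` (A `\` B))).
by rewrite fmu.2 ?mu1; [lra|apply/seteqP; split=> x // [? []]].
Qed.

(* Double counting of the total mass of A_1, ..., A_n inside E, without integrals:
   peel off one set A at a time, the bound t drops by one on E `&` A. *)
Lemma sum_content_le (R : realType) (X : Type) (mu : set X -> R) (s : seq (set X))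
    (E : set X) (t : R) :
  finitely_additive mu -> (forall x, E x -> (count (fun A => x \in A) s)%:R <= t) ->
  \sum_(A <- s) mu (A `&` E) <= t * mu E.
Proof.
move=> fmu; elim: s E t => [|A s IH] E t h.
  rewrite big_nil; have [->|/set0P[x Ex]] := eqVneq E set0.
    by rewrite (content0 fmu) mulr0.
  by rewrite mulr_ge0 ?fmu.1 //; apply: le_trans (h x Ex).
have h1 x : (E `&` A) x -> (count (fun A => x \in A) s)%:R <= t - 1.
  by move=> [Ex Ax]; have := h x Ex; rewrite /= mem_set //= add1n -natr1; lra.
have h2 x : (E `\` A) x -> (count (fun A => x \in A) s)%:R <= t.
  by move=> [Ex Ax]; have := h x Ex; rewrite /= memNset.
have := lerD (IH _ _ h1) (IH _ _ h2); rewrite -big_split /= big_cons.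
rewrite (eq_bigr (fun A' => mu (A' `&` E))) => [|A' _]; last first.
  by rewrite (content_split (A' `&` E) A fmu) setDE !setIA.
have := content_split E A fmu; rewrite (setIC A) => ->; lra.
Qed.

Lemma exists_frequent_point (R : realType) (X : Type) (mu : set X -> R)
    (s : seq (set X)) (d : R) :
  finitely_additive mu -> mu setT = 1 -> (forall A, A \in s -> d <= mu A) ->
  exists x, d * (size s)%:R <= (count (fun A => x \in A) s)%:R.
Proof.
move=> fmu mu1 ds; apply: contrapT => /forallNP h.
have X0 : exists x : X, True.
  apply: contrapT => /forallNP X0; have := content0 fmu.
  rewrite (_ : set0 = setT) ?mu1; first by move/eqP; rewrite oner_eq0.
  by apply/seteqP; split=> x // _; apply: (X0 x).
have [x0 _] := X0.
(* Frequencies are integers bounded by [size s], so a largest one is attained; it is a uniform bound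
   still strictly below [d * size s]. *)
pose P n := `[< exists x, count (fun A => x \in A) s = n >].
have exP : exists n, P n by exists (count (fun A => x0 \in A) s); apply/asboolP; exists x0.
have ubP n : P n -> (n <= size s)%N by move=> /asboolP[x <-]; apply: count_size.
have [n /asboolP[x <-] nmax] := ex_maxnP exP ubP.
have ltn : (count (fun A => x \in A) s)%:R < d * (size s)%:R.
  by have /negP := h x; rewrite -ltNge.
have /(sum_content_le fmu) : forall y, setT y ->
    (count (fun A => y \in A) s)%:R <= (count (fun A => x \in A) s)%:R :> R.
  by move=> y _; rewrite ler_nat; apply: nmax; apply/asboolP; exists y.
rewrite mu1 mulr1 => le1; suff : d * (size s)%:R <= (count (fun A => x \in A) s)%:R by rewrite leNgt ltn.
apply: le_trans le1.
have -> : d * (size s)%:R = \sum_(A <- s) d.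
  by rewrite big_const_seq count_predT iter_addr_0 mulr_natr.
by rewrite big_seq [leRHS]big_seq ler_sum // => A /ds; rewrite setIT.
Qed.

(** Each new point is a frequent point of the sets not yet hit, so every round leaves at most a
    fraction [1 - d] of them. *)
Lemma greedy_hitting (R : realType) (X : Type) (mu : set X -> R) (d : R) (m : nat)
    (s : seq (set X)) :
  finitely_additive mu -> mu setT = 1 -> d <= 1 -> (forall A, A \in s -> d <= mu A) ->
  exists2 xs : seq X, size xs = m &
    (count (fun A => ~~ has (fun x => x \in A) xs) s)%:R <= (1 - d) ^+ m * (size s)%:R.
Proof.
move=> fmu mu1 d1; elim: m s => [|m IH] s ds.
  by exists [::] => //; rewrite expr0 mul1r ler_nat count_size.
have [x xs] := exists_frequent_point fmu mu1 ds.
pose s' := [seq A <- s | x \notin A].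
have [|ys sy hy] := IH s'; first by move=> A; rewrite mem_filter => /andP[_ /ds].
exists (x :: ys); first by rewrite /= sy.
have -> : count (fun A => ~~ has (fun x => x \in A) (x :: ys)) s =
          count (fun A => ~~ has (fun x => x \in A) ys) s'.
  by rewrite count_filter; apply: eq_count => A /=; rewrite negb_or andbC.
apply: le_trans hy _; rewrite exprSr -mulrA ler_wpM2l ?exprn_ge0 ?subr_ge0 //.
have : size s = (count (fun A => x \in A) s + size s')%N.
  by rewrite size_filter count_predC.
by move: xs => /[swap] ->; rewrite natrD; lra.
Qed.

(** * Families of bounded VC dimension and their finite approximation *)

Definition unshattered (X : Type) (B : set (set X)) (r : nat) :=
  forall x : 'I_r -> X, injective x -> exists J : {set 'I_r},
    forall b, B b -> exists i, (x i \in b) != (i \in J).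

(** The traces of the [b i] on the points [x] are [N] distinct subsets of ['I_m]; were there more
    than the Sauer-Shelah bound, [r] indices would be shattered. *)
Lemma card_traces_le (X : Type) (B : set (set X)) (r m N : nat)
    (b : 'I_N -> set X) (x : 'I_m -> X) :
  unshattered B r -> (forall i, B (b i)) ->
  (forall i j : 'I_N, (i < j)%N -> exists k, (x k \in b i) != (x k \in b j)) ->
  (N <= m.+1 ^ r)%N.
Proof.
move=> unB Bb sepb.
pose tr i : {set 'I_m} := [set k | x k \in b i]%SET.
pose F := [set tr i | i in 'I_N]%SET.
have trI : injective tr.
  move=> i j eqij; apply/val_inj; apply/eqP.
  have sep (i' j' : 'I_N) : tr i' = tr j' -> ~~ (i' < j')%N.
    move=> /setP eq; apply/negP => /sepb[k /eqP]; apply.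
    by have := eq k; rewrite !inE.
  by rewrite eqn_leq leqNgt (sep j i) //= leqNgt sep.
rewrite -[N in (N <= _)%N]card_ord -(card_imset _ trI) -[m in m.+1]card_ord leqNgt.
apply/negP => /sauer_shelah[S rS /shattersP shS].
pose e (i : 'I_r) : 'I_m := enum_val (widen_ord rS i).
have eS i : e i \in S by apply: enum_valP.
have eI : injective e.
  by move=> i j /enum_val_inj /(congr1 val) /= ij; apply: val_inj.
have real (A : {set 'I_m}) : A \subset S ->
    exists2 i, B (b i) & forall k, (x (e k) \in b i) = (e k \in A).
  move=> /shS[D /imsetP[i _ ->] DS]; exists i => // k.
  by rewrite -DS !inE eS andbT.
(* The points [x] may repeat, but not on the shattered indices: a member with trace [[set e i]]
   separates [x (e i)] from the others. *)
have xeI : injective (x \o e).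
  move=> i j /= eqx; have [k _ hk] := real [set e i]%SET ltac:(by rewrite finset.sub1set).
  by have := hk j; rewrite -eqx hk !inE eqxx => /esym/eqP/eI.
have [J hJ] := unB _ xeI.
have [k Bk hk] := real (e @: J) ltac:(by apply/fintype.subsetP => _ /imsetP[i _ ->]).
by have [i /=] := hJ _ Bk; rewrite hk mem_imset // eqxx.
Qed.

(** The greedy points hit all pairwise symmetric differences, since fewer than one of them is
    missed; hence they tell the members of [bs] apart and [card_traces_le] applies. *)
Lemma separated_size_le (R : realType) (X : Type) (B : set (set X)) (r : nat)
    (mu : set X -> R) (d : R) (bs : seq (set X)) (m : nat) :
  finitely_additive mu -> mu setT = 1 -> unshattered B r -> d <= 1 ->
  (forall b, b \in bs -> B b) ->
  pairwise (fun a b => d <= mu ((a `\` b) `|` (b `\` a))) bs ->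
  (1 - d) ^+ m * (size bs ^ 2)%:R < 1 ->
  (size bs <= m.+1 ^ r)%N.
Proof.
move=> fmu mu1 unB d1 Bbs /(pairwiseP setT) sep small.
pose N := size bs; pose b (i : 'I_N) := nth setT bs i.
pose P := enum [pred p : 'I_N * 'I_N | (p.1 < p.2)%N].
pose s := [seq (b p.1 `\` b p.2) `|` (b p.2 `\` b p.1) | p <- P].
have [|xs xsm hits] := @greedy_hitting R X mu d m s fmu mu1 d1.
  by move=> A /mapP[p]; rewrite mem_enum inE => lt ->; apply: sep; rewrite ?inE.
have sizes : (size s <= N ^ 2)%N.
  by rewrite size_map -cardE (leq_trans (max_card _)) // card_prod card_ord.
have : (count (fun A => ~~ has (fun x => x \in A) xs) s)%:R < 1 :> R.
  apply: le_lt_trans hits (le_lt_trans _ small).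
  by rewrite ler_wpM2l ?exprn_ge0 ?subr_ge0 // ler_nat.
rewrite -[1]/(1%:R) ltr_nat ltnS leqn0 -[_ == _]negbK -lt0n -has_count.
move=> /hasPn hit; rewrite -xsm.
apply: (@card_traces_le X B r _ N b (tnth (in_tuple xs)) unB).
  by move=> i; apply: Bbs; apply: mem_nth.
move=> i j ij.
have /hit : (b i `\` b j) `|` (b j `\` b i) \in s.
  by apply/mapP; exists (i, j) => //; rewrite mem_enum inE.
rewrite negbK => /(@has_tnthP _ _ _ (in_tuple xs))[k]; rewrite inE => hk; exists k.
by move: hk => [[bi bj]|[bj bi]]; [rewrite (mem_set bi) (memNset bj) | rewrite (memNset bi) (mem_set bj)].
Qed.

Lemma bernoulli_le (R : realType) (a : R) (n : nat) :
  0 <= a -> 1 + n%:R * a <= (1 + a) ^+ n.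
Proof.
move=> a0; elim: n => [|n IH]; first by rewrite expr0; lra.
rewrite exprS -natr1; have : 0 <= n%:R :> R by [].
nra.
Qed.

Lemma exists_poly_lt_exp (R : realType) (a : R) (k : nat) :
  0 < a -> exists m, (m.+2%:R) ^+ k < (1 + a) ^+ m.
Proof.
(* With [m = s * k.+1], Bernoulli gives [(s * a) ^+ k.+1 <= (1 + a) ^+ m], while [m.+2 <= K * s]; so
   [s] is chosen with [K ^+ k < s * a ^+ k.+1]. *)
move=> a0; pose K := (k.+1 + 2)%N.
have [s s0 hs] : exists2 s, (0 < s)%N & K%:R ^+ k < s%:R * a ^+ k.+1.
  exists (Num.bound (K%:R ^+ k / a ^+ k.+1)).+1 => //.
  rewrite -ltr_pdivrMr ?exprn_gt0 //; apply: lt_trans (archi_boundP _) _.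
    by rewrite divr_ge0 ?exprn_ge0 // ltW.
  by rewrite ltr_nat.
exists (s * k.+1)%N; rewrite exprM.
have bern : s%:R * a <= (1 + a) ^+ s.
  by have := bernoulli_le s (ltW a0); lra.
apply: lt_le_trans (_ : (s%:R * a) ^+ k.+1 <= _); last first.
  by rewrite lerXn2r ?nnegrE ?exprn_ge0 ?mulr_ge0 ?addr_ge0 // ltW.
apply: le_lt_trans (_ : (K%:R * s%:R) ^+ k < _).
  rewrite lerXn2r ?nnegrE ?mulr_ge0 // -natrM ler_nat /K mulnDl mulnC.
  by rewrite -addn2 leq_add2l leq_pmulr.
rewrite !exprMn mulrC [in ltRHS]exprS -mulrA mulrCA ltr_pM2l //.
by rewrite exprn_gt0 // ltr0n.
Qed.

(** A separated list is extended by any element that it does not cover, until it covers [B] or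
    reaches length [n]. *)
Lemma greedy_net (T : eqType) (B : set T) (close : rel T) (n : nat) :
  (exists s : seq T, [/\ (size s <= n)%N, {in s, forall a, B a}
     & forall b, B b -> has (close b) s]) \/
  (exists s : seq T, [/\ size s = n, {in s, forall a, B a}
     & pairwise (fun a b => ~~ close a b) s]).
Proof.
elim: n => [|n [[s [sn Bs cov]]|[s [sn Bs sep]]]]; first by right; exists [::].
  by left; exists s; split=> //; apply: leq_trans sn _.
have [cov|/existsNP[b /not_implyP[Bb /negP nb]]] := pselect (forall b, B b -> has (close b) s).
  by left; exists s; split=> //; rewrite sn.
right; exists (b :: s); split=> /=; rewrite ?sn // ?sep ?andbT; last first.
  by rewrite all_predC.
by move=> a; rewrite inE => /orP[/eqP ->//|/Bs].
Qed.

(** A separated list of length [(m.+1 ^ r).+1] would violate [separated_size_le], so the greedy list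
    must cover. As [m] depends only on [r] and [d], the bound is uniform in [mu]. *)
Lemma exists_finite_cover (R : realType) (X : Type) (B : set (set X)) (r : nat) (d : R) :
  unshattered B r -> 0 < d ->
  exists N, forall mu : set X -> R, finitely_additive mu -> mu setT = 1 ->
    exists s : seq (set X), [/\ (size s <= N)%N, {in s, forall a, B a} &
      forall b, B b -> has (fun g => mu ((b `\` g) `|` (g `\` b)) < d) s].
Proof.
move=> unB d0; pose e := Num.min d 2^-1.
have e0 : 0 < e by rewrite lt_min d0 /=; lra.
have e1 : e <= 2^-1 by rewrite ge_min lexx orbT.
(* The square of [(m.+1 ^ r).+1] is at most [m.+2 ^ (2 * r.+1)], hence below [(1 + e) ^+ m], and
   [(1 - e) ^+ m * (1 + e) ^+ m <= 1]. *)
have [m hm] := exists_poly_lt_exp (2 * r.+1) e0.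
exists (m.+1 ^ r).+1 => mu fmu mu1.
have [[s [sN Bs cov]]|[s [sN Bs sep]]] := greedy_net B
    (fun b g => mu ((b `\` g) `|` (g `\` b)) < e) (m.+1 ^ r).+1.
  exists s; split=> // b /cov; apply: sub_has => g lt.
  by apply: lt_le_trans lt _; rewrite ge_min lexx.
suff : ((m.+1 ^ r).+1 <= m.+1 ^ r)%N by rewrite ltnn.
rewrite -{1}sN; apply: (@separated_size_le R X B r mu e s m fmu mu1 unB) => //.
- by lra.
- by move: sep; congr (is_true (pairwise _ s)); apply/funext => a; apply/funext => b; rewrite -leNgt.
apply: le_lt_trans (_ : (1 - e) ^+ m * m.+2%:R ^+ (2 * r.+1) < _).
  rewrite ler_wpM2l ?exprn_ge0 //; first by lra.
  rewrite -natrX ler_nat sN mulnC expnM leq_exp2r //.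
  have : (0 < m.+2 ^ r)%N by rewrite expn_gt0.
  have : (m.+1 ^ r <= m.+2 ^ r)%N by case: (r) => // k; rewrite leq_exp2r.
  rewrite expnS !mulSn; lia.
have e1m : 0 < (1 - e) ^+ m by rewrite exprn_gt0 //; lra.
apply: lt_le_trans (_ : (1 - e) ^+ m * (1 + e) ^+ m <= _); first by rewrite ltr_pM2l.
rewrite -exprMn exprn_ile1 //; nra.
Qed.

(** * Radon partitions, half-spaces and Helly's theorem *)

(** [p] is a Radon point of the tuple: it lies in the hulls of both parts, taken in the whole space
    rather than in some [c i]. *)
Definition radon_partitions (X : Type) (C : set (set X)) (r : nat) :=
  forall x : 'I_r -> X, injective x -> exists (J : {set 'I_r}) (p : X),
    (forall d, C d -> (forall i, i \in J -> d (x i)) -> d p) /\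
    (forall d, C d -> (forall i, i \notin J -> d (x i)) -> d p).

Lemma chain_finite_subset (X : Type) (c : nat -> set X) (I : finType) (x : I -> X) :
  (forall i, c i `<=` c i.+1) -> \bigcup_i c i = setT ->
  exists n, forall k, c n (x k).
Proof.
move=> cS cT; have cmono : {homo c : m n / (m <= n)%N >-> m `<=` n}.
  move=> m n /subnK <-; elim: (n - m)%N => // k IH.
  by apply: subset_trans IH _; rewrite addSn; apply: cS.
have /choice[n cn] : forall k, exists n, c n (x k).
  by move=> k; have : setT (x k) by []; rewrite -cT => -[i _]; exists i.
by exists (\max_k n k)%N => k; apply: cmono (cn k); apply: leq_bigmax.
Qed.

(** All points lie in one [c n], where the first [r'] of them have a Radon partition. Hulls
    restricted to [c n] lie inside the hulls in [X], because [d] restricts to a convex set of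
    [c n]. *)
Lemma chain_radon_partitions (X : Type) (C : set (set X)) (r : nat) (c : nat -> set X) :
  convexity_space C -> (forall i, c i `<=` c i.+1) -> (forall i, C (c i)) ->
  (forall i, convex_radon_le C (c i) r) -> \bigcup_i c i = setT ->
  radon_partitions C r.
Proof.
move=> [_ [_ CI]] cS Cc rad cT x xI.
have [n cx] := chain_finite_subset x cS cT.
have [r' rr' radn] := rad n.
pose Y := range (x \o widen_ord rr').
have Yn : Y `<=` c n by move=> _ [i _ <-]; apply: cx.
have Yr : (Y #= `I_r')%card.
  rewrite (card_eqr card_II); apply: inj_card_eq.
  by move=> i j _ _ /= /xI /(congr1 val) /= ij; apply: val_inj.
have /existsNP[Y1 /existsNP[Y2 /not_implyP[Y12 /not_implyP[Y0 /eqP/set0P[p [p1 p2]]]]]] :=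
  radn Y Yn Yr.
have inconv Y' d : Y' `<=` Y -> Defs.conv (c n) (Defs.restrict C (c n)) Y' p -> C d -> Y' `<=` d -> d p.
  move=> Y'Y [_ hp] Cd Y'd; suff [] : (d `&` c n) p by [].
  apply: hp; split; first by exists d.
  by move=> y Yy; split; [apply: Y'd|apply/Yn/Y'Y].
(* Indices from [r'] on fall outside [J]; this only enlarges the hull of that part. *)
exists [set k | x k \in Y1]%SET, p; split=> d Cd h.
  apply: inconv p1 Cd _ => [|y Y1y]; first by rewrite -Y12; apply: subsetUl.
  have [i _ /= iy] : Y y by rewrite -Y12; left.
  by rewrite -iy; apply: h; rewrite inE mem_set //= iy.
apply: inconv p2 Cd _ => [|y Y2y]; first by rewrite -Y12; apply: subsetUr.
have [i _ /= iy] : Y y by rewrite -Y12; right.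
rewrite -iy; apply: h; rewrite inE memNset //= iy => Y1y.
have : set0 y by rewrite -Y0.
by [].
Qed.

(** If [b] had trace [J], its complement [b'] on [Y] would contain the other points, so the Radon
    point [p] would lie in both. Putting [p] into [Y] makes this contradict disjointness. *)
Lemma halfspaces_unshattered (X : Type) (B C : set (set X)) (r : nat) :
  radon_partitions C r -> B `<=` C ->
  (forall Y : set X, finite_set Y -> forall b, B b ->
     exists2 b', B b' &
       (b `&` Y) `|` (b' `&` Y) = Y /\ (b `&` Y) `&` (b' `&` Y) = set0) ->
  unshattered B r.
Proof.
move=> rad BC sep x /rad[J [p [pJ pJc]]]; exists J => b Bb.
apply: contrapT => /forallNP tr.
have {}tr i : x i \in b = (i \in J) by apply/eqP; have /negP := tr i; rewrite negbK.
pose Y := range x `|` [set p].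
have finY : finite_set Y.
  by rewrite finite_setU; split=> //; apply: finite_image.
have [b' Bb' [bU bI]] := sep Y finY b Bb.
have bp : b p by apply: pJ (BC _ Bb) _ => i; rewrite -tr inE.
have b'p : b' p.
  apply: pJc (BC _ Bb') _ => i; rewrite -tr notin_setE => nb.
  have : Y (x i) by left; exists i.
  by rewrite -bU => -[[]|[]].
have : set0 p by rewrite -bI; split; split=> //; right.
by [].
Qed.

(** Radon's argument: induction gives, for each [i], a point [x i] in all sets but possibly [A i],
    and a Radon point of [r] such points lies in every set. *)
Lemma helly (X : Type) (C : set (set X)) (r n : nat) (A : 'I_n -> set X) :
  radon_partitions C r -> (forall i, C (A i)) ->
  (forall J : {set 'I_n}, (#|J| <= r)%N -> exists x, forall i, i \in J -> A i x) ->
  exists x, forall i, A i x.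
Proof.
move=> rad; elim: n A => [|n IH] A CA hA.
  by have [|x _] := hA finset.set0; [rewrite cards0|exists x => -[]].
have [rn|nr] := leqP r n.+1; last first.
  by have [|x hx] := hA [set: 'I_n.+1]%SET; [rewrite cardsT card_ord ltnW|
     exists x => i; apply: hx; rewrite inE].
have /choice[x hx] : forall i, exists x, forall j, j != i -> A j x.
  move=> i; have [|J Jr|x hx] := IH (A \o lift i); first by move=> j; apply: CA.
    have [|x hx] := hA (lift i @: J); first by rewrite (leq_trans (leq_imset_card _ _)).
    by exists x => j jJ; apply: hx; apply: imset_f.
  exists x => j; rewrite eq_sym => /unlift_some[k -> _]; exact: hx.
(* If [x i = x j] with [i != j], this point lies in [A i] too, hence in all sets. *)
have [xI|] := pselect (injective x); last first.
  move=> /existsNP[i /existsNP[j /not_implyP[xij /eqP ij]]].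
  exists (x i) => k; have [->|] := eqVneq k i; last exact: hx.
  by rewrite xij; apply: hx.
have wI : injective (x \o widen_ord rn).
  by move=> i j /xI /(congr1 val) /= ij; apply: val_inj.
have [J [p [pJ pJc]]] := rad _ wI; exists p => k.
(* One part of the partition avoids the index [k]; its points all lie in [A k], and so does [p]. *)
have [kJ|kJ] := boolP [exists i in J, widen_ord rn i == k].
  apply: pJc => // i iJ; apply: hx; apply: contraNneq iJ => ki.
  have /exists_inP[j jJ /eqP jk] := kJ.
  by rewrite (_ : i = j) //; apply: val_inj; rewrite -[val i]/(val (widen_ord rn i)) -ki -jk.
apply: pJ => // i iJ; apply: hx; apply: contraNneq kJ => ki.
by apply/exists_inP; exists i => //; rewrite ki.
Qed.

(** * Probability distributions and centerpoints *)

Lemma prob_distr_finitely_additive (R : realType) (X : Type) (mu : set X -> R) :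
  prob_distr mu -> finitely_additive mu.
Proof.
move=> [mu0 [_ muS]].
have mu00 : mu set0 = 0.
  have tr : trivIset setT (fun _ : nat => @set0 X) by move=> i j _ _ [x []].
  have := muS _ tr; rewrite bigcup0 // => cv.
  apply/eqP; rewrite eq_le mu0 andbT leNgt; apply/negP => pos.
  (* For the constantly empty sequence the partial sums are multiples of [mu set0]; one with at
     least two terms cannot be below [2 * mu set0]. *)
  have [|n _ /(_ n.+2 ltac:(by rewrite /= ltnW))] := cvgr_lt _ cv (2 * mu set0); first by lra.
  by rewrite sumr_const card_ord mulr_natl ltr_pMn2l.
split=> // A B AB0.
have tr : trivIset setT (bigcup2 A B) by rewrite -trivIset_bigcup2.
have := muS _ tr; rewrite bigcup2E => cv.
apply: (cvg_unique (@norm_hausdorff _ R^o) cv).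
apply: cvg_near_cst; exists 2 => //= -[|[|n]] // _.
by rewrite !big_ord_recl /= big1 ?addr0.
Qed.

(** Continuity from below: the masses of the disjoint increments [seqD c] sum to [mu (c n)] and
    converge to 1. *)
Lemma chain_measure_gt (R : realType) (X : Type) (mu : set X -> R) (c : nat -> set X) (t : R) :
  prob_distr mu -> (forall i, c i `<=` c i.+1) -> \bigcup_i c i = setT -> t < 1 ->
  exists n, t < mu (c n).
Proof.
move=> pmu cS cT t1; have fmu := prob_distr_finitely_additive pmu.
have cmono : {homo c : m n / (m <= n)%N >-> (m <= n)%O}.
  move=> m n /subnK <-; rewrite subsetEset; elim: (n - m)%N => // k IH.
  by apply: subset_trans IH _; rewrite addSn; apply: cS.
have sumD n : \sum_(i < n.+1) mu (seqD c i) = mu (c n).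
  elim: n => [|n IH]; first by rewrite big_ord_recl big_ord0 addr0.
  rewrite big_ord_recr IH (setU_seqD cmono) fmu.2 //.
  by apply/seteqP; split=> x // [? []].
have := pmu.2.2 _ (trivIset_seqD cmono); rewrite eq_bigcup_seqD cT pmu.2.1.
move=> /cvgr_gt/(_ _ t1)[n _ hn]; exists n; rewrite -sumD; apply: hn => /=; exact: leqnSn.
Qed.

Lemma prob_distr_cond (R : realType) (X : Type) (mu : set X -> R) (g : set X) :
  prob_distr mu -> 0 < mu g -> prob_distr (fun A => mu (A `&` g) / mu g).
Proof.
move=> [mu0 [mu1 muS]] g0; split; first by move=> A; rewrite divr_ge0 // ltW.
split; first by rewrite setTI divff // gt_eqF.
move=> F tF; rewrite setI_bigcupl.
under eq_fun do rewrite -mulr_suml.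
by apply: cvgMr_tmp; apply: muS; apply: trivIset_setIr.
Qed.

Lemma convexI (X : Type) (C : set (set X)) A B :
  convexity_space C -> C A -> C B -> C (A `&` B).
Proof.
move=> [_ [_ CI]] CA CB; rewrite -bigcap2E.
have -> : \bigcap_i bigcap2 A B i = \bigcap_(d in [set A; B]) d.
  by rewrite bigcap2E bigcap_setU !bigcap_set1.
by apply: CI => d [->|->].
Qed.

(** Union bound; a large subset [E] of the intersection suffices to find a common point. *)
Lemma content_big_inter (R : realType) (X : Type) (mu : set X -> R) (e : R)
    (I : eqType) (A : I -> set X) (s : seq I) :
  finitely_additive mu -> mu setT = 1 -> (forall i, 1 - e <= mu (A i)) ->
  exists2 E : set X, {in s, forall i, E `<=` A i} & 1 - (size s)%:R * e <= mu E.
Proof.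
move=> fmu mu1 Ae; elim: s => [|i s [E EA hE]]; first by exists setT; rewrite ?mu1 ?mul0r ?subr0.
exists (A i `&` E).
  move=> j; rewrite inE => /orP[/eqP ->|/EA Ej]; first exact: subIsetl.
  exact: subset_trans (@subIsetr _ _ _) Ej.
by have := content_capI (A i) E fmu mu1; have := Ae i; rewrite /= -natr1; lra.
Qed.

(** Cutting a set of mass above [1 - eta] down to a [c n] of such mass leaves more than
    [1 - 2 * eta]. By the union bound any [r] of these sets meet, by Helly finitely many meet, and
    by compactness of [c n] all do. *)
Lemma centerpoint (R : realType) (X : Type) (C : set (set X)) (r : nat)
    (c : nat -> set X) (mu : set X -> R) (eta : R) :
  convexity_space C -> radon_partitions C r -> (forall i, c i `<=` c i.+1) ->
  (forall i, compact_convex C (c i)) -> \bigcup_i c i = setT -> prob_distr mu ->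
  0 < eta -> r%:R * (2 * eta) < 1 ->
  exists p, forall d, C d -> 1 - eta < mu d -> d p.
Proof.
move=> cvx rad cS cc cT pmu eta0 reta.
have fmu := prob_distr_finitely_additive pmu; have mu1 := pmu.2.1.
have [n cn] : exists n, 1 - eta < mu (c n) by apply: chain_measure_gt => //; lra.
have [Ccn cpt] := cc n.
have inter (s : seq (set X)) : {in s, forall d, C d /\ 1 - 2 * eta <= mu d} ->
    exists x, {in s, forall d : set X, d x}.
  move=> hs; have hs' (i : 'I_(size s)) := hs _ (mem_nth setT (ltn_ord i)).
  have [||x hx] := @helly X C r _ (fun i : 'I_(size s) => nth setT s i) rad.
  - by move=> i; have [] := hs' i.
  - move=> J Jr; have [|E EA hE] := content_big_inter (e := 2 * eta) (enum J) fmu mu1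
      (A := fun i : 'I_(size s) => nth setT s i); first by move=> i; have [] := hs' i.
    have [E0|/set0P[x Ex]] := eqVneq E set0; last first.
      by exists x => i iJ; apply: EA Ex; rewrite mem_enum.
    move: hE; rewrite E0 (content0 fmu) -cardE.
    have : #|J|%:R * (2 * eta) <= r%:R * (2 * eta).
      by rewrite ler_wpM2r ?ler_nat // mulr_ge0 // ltW.
    lra.
  exists x => d ds; have id : (index d s < size s)%N by rewrite index_mem.
  by have := hx (Ordinal id); rewrite /= nth_index.
apply: contrapT => /forallNP nop.
pose D' := [set d `&` c n | d in [set d | C d /\ 1 - eta < mu d]].
have [||D'' [D''D' /finite_seqP[s D''s]] D''0] := cpt D'.
- by move=> _ [d [Cd _] <-]; exists d.
- apply/eqP; apply: contrapT => /negP/set0P[p [cp hp]]; apply: (nop p) => d Cd de.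
  by have [] := hp (d `&` c n) ltac:(by exists d).
(* Adding [c n] to the list keeps the common point in [c n] even if [D''] is empty. *)
have [|x hx] := inter (c n :: s).
  move=> d; rewrite inE => /orP[/eqP ->|ds]; first by split=> //; lra.
  have [d' [Cd' d'e] <-] : D' d by apply: D''D'; rewrite D''s.
  split; first exact: convexI.
  by have := content_capI d' (c n) fmu mu1; lra.
have : set0 x; last by [].
rewrite -D''0; split; first by apply: hx; rewrite inE eqxx.
by move=> d; rewrite D''s => /= ds; apply: hx; rewrite inE ds orbT.
Qed.

(** * Weak nets by recursion on the threshold *)

Definition net_at (R : realType) (X : Type) (C : set (set X)) (e : R) :=
  exists N, forall mu : set X -> R, prob_distr mu ->
    exists2 s : seq X, (size s <= N)%N &
      forall d, C d -> e <= mu d -> has (fun x => x \in d) s.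

(* A convex d missing the centerpoint lies in some half-space b with mu b <= 1 - eta,
   so d is relatively heavier inside a member g of a finite cover close to b. *)
Lemma net_at_step (R : realType) (X : Type) (B C : set (set X)) (r : nat)
    (eta e : R) :
  unshattered B r -> 0 < eta <= 1 -> 0 < e ->
  C `<=` [set \bigcap_(b in F) b | F in [set F : set (set X) | F `<=` B]] ->
  B `<=` C ->
  (forall mu : set X -> R, prob_distr mu ->
     exists p, forall d, C d -> 1 - eta < mu d -> d p) ->
  net_at C ((1 + eta / 2) * e) -> net_at C e.
Proof.
move=> unB /andP[eta0 eta1] e0 CB BC center [N netN].
have d0 : 0 < e * eta / 4 by rewrite divr_gt0 ?mulr_gt0.
have [K cover] := exists_finite_cover unB d0.
exists (K * N).+1 => mu pmu.
have fmu := prob_distr_finitely_additive pmu; have mu1 := pmu.2.1.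
have [p hp] := center mu pmu.
have [gs [gsK _ hgs]] := cover mu fmu mu1.
have [s sN hs] : exists2 s : seq X, (size s <= size gs * N)%N &
    {in gs, forall g, 0 < mu g -> forall d, C d ->
       (1 + eta / 2) * e <= mu (d `&` g) / mu g -> has (fun x => x \in d) s}.
  elim: (gs) => [|g gs' [s sN hs]]; first by exists [::].
  have [t tN ht] : exists2 t : seq X, (size t <= N)%N & 0 < mu g -> forall d, C d ->
       (1 + eta / 2) * e <= mu (d `&` g) / mu g -> has (fun x => x \in d) t.
    (* Conditioning requires positive mass; a null [g] contributes no points. *)
    have [g0|g0] := boolP (0 < mu g); last by exists [::].
    by have [t tN ht] := netN _ (prob_distr_cond pmu g0); exists t.
  exists (t ++ s); first by rewrite size_cat mulSn leq_add.
  move=> g'; rewrite inE => /orP[/eqP ->|g's] g'0 d Cd dg; rewrite has_cat.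
    by rewrite ht.
  by rewrite (hs g') // orbT.
exists (p :: s); first by rewrite /= ltnS (leq_trans sN) // leq_mul2r gsK orbT.
move=> d Cd ed /=; have [dp|ndp] := pselect (d p); first by rewrite mem_set.
apply/orP; right.
have [b [Bb nbp db]] : exists b, [/\ B b, ~ b p & d `<=` b].
  have [F FB Fd] := CB _ Cd.
  have : ~ (\bigcap_(b in F) b) p by rewrite Fd.
  move=> /existsNP[b /not_implyP[Fb nbp]]; exists b; split=> //; first exact: FB.
  by rewrite -Fd; apply: bigcap_inf.
have mub : mu b <= 1 - eta by rewrite leNgt; apply/negP => /(hp _ (BC _ Bb)).
have /hasP[g ggs bg] := hgs _ Bb.
have dg : mu (d `\` g) <= mu ((b `\` g) `|` (g `\` b)).
  by apply: le_content => // x [dx ngx]; left; split=> //; apply: db.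
have gb : mu (g `\` b) <= mu ((b `\` g) `|` (g `\` b)).
  by apply: le_content => // x ?; right.
have ib : mu (g `&` b) <= mu b by apply: le_content => // x [].
have ig : mu (d `&` g) <= mu g by apply: le_content => // x [].
have d1 : mu d <= 1 by rewrite -mu1; apply: le_content.
have sd := content_split d g fmu; have sg := content_split g b fmu.
have e1 : e <= 1 by lra.
have ee : e * eta <= e by rewrite ler_piMr // ltW.
have eeta : e * eta <= eta by rewrite ler_piMl // ltW.
have lo : e - e * eta / 4 <= mu (d `&` g) by lra.
have hi : mu g <= 1 - 3 / 4 * eta by lra.
have g0 : 0 < mu g by lra.
apply: (hs g) => //; rewrite ler_pdivlMr //; apply: le_trans lo.
(* The error [e * eta / 4] fits here: [(1 + eta / 2) * (1 - 3 / 4 * eta)] equals [1 - eta / 4] minus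
   [3 / 8 * eta ^+ 2]. *)
apply: le_trans (_ : (1 + eta / 2) * e * (1 - 3 / 4 * eta) <= _).
  by rewrite ler_wpM2l // mulr_ge0 //; lra.
have : 0 <= e * eta * eta by rewrite !mulr_ge0 // ltW.
lra.
Qed.

Theorem theorem6 (R : realType) (X : Type) (C : set (set X)) (r : nat)
  (c : nat -> set X) :
  convexity_space C ->
  locally_separable C ->
  (forall i, c i `<=` c i.+1) ->
  (forall i, compact_convex C (c i)) ->
  (forall i, convex_radon_le C (c i) r) ->
  \bigcup_i c i = setT ->
  forall eps : R, 0 < eps -> has_finite_weak_eps_nets C eps.
Proof.
move=> cvx [B [BC [CE sep]]] cS cc crad cT eps eps0.
have rad : radon_partitions C r.
  by apply: chain_radon_partitions cvx cS _ crad cT => i; have [] := cc i.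
have unB := halfspaces_unshattered rad BC sep.
(* This choice gives [r * (2 * eta) = r / (r + 1) < 1], as [centerpoint] requires. *)
pose eta : R := (2 * r.+1%:R)^-1.
have r0 : 0 < r.+1%:R :> R by rewrite ltr0n.
have eta0 : 0 < eta by rewrite invr_gt0 mulr_gt0.
have reta : r.+1%:R * (2 * eta) = 1 by rewrite /eta; field; rewrite gt_eqF.
have eta1 : eta <= 1.
  have : 1 <= r.+1%:R :> R by rewrite ler1n.
  nra.
have center (mu : set X -> R) : prob_distr mu ->
    exists p, forall d, C d -> 1 - eta < mu d -> d p.
  move=> pmu; apply: (centerpoint cvx rad cS cc cT pmu eta0).
  by move: reta; rewrite -natr1; lra.
have CB : C `<=` [set \bigcap_(b in F) b | F in [set F : set (set X) | F `<=` B]].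
  by rewrite -CE.
have down k (e : R) : 0 < e -> net_at C ((1 + eta / 2) ^+ k * e) -> net_at C e.
  elim: k e => [|k IH] e e0; first by rewrite expr0 mul1r.
  rewrite exprSr -mulrA => /IH h.
  apply: (net_at_step unB _ e0 CB BC center); first by rewrite eta0.
  by apply: h; rewrite mulr_gt0 //; lra.
(* By Bernoulli [(1 + eta / 2) ^+ k] is at least [1 + k * (eta / 2)], which exceeds [eps^-1]. *)
pose k := Num.bound (eps^-1 / (eta / 2)).
have hk : 1 < (1 + eta / 2) ^+ k * eps.
  rewrite -ltr_pdivrMr // mul1r; apply: lt_le_trans (bernoulli_le k _); last by lra.
  have : eps^-1 < k%:R * (eta / 2); last by lra.
  by rewrite -ltr_pdivrMr ?archi_boundP ?divr_ge0 ?invr_ge0 ?ltW //; lra.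
have [N netN] : net_at C eps.
  (* At a threshold above 1 no set qualifies, so the empty list is a net. *)
  apply: (down k) => //; exists 0%N => mu pmu; exists [::] => // d _.
  have := le_content (prob_distr_finitely_additive pmu) (@subsetT _ d).
  by rewrite pmu.2.1; lra.
exists N => mu pmu; have [s sN hs] := netN mu pmu.
(* A default value for [nth]: the list may be shorter than [N]. *)
have [x0 _] := center mu pmu.
exists (nth x0 s) => d Cd /(hs d Cd) /(has_nthP x0)[i si di].
exists (nth x0 s i); split; first by rewrite -in_setE.
by exists i => //=; apply: leq_trans si sN.
Qed.
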